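(* For a Boolean algebra $B$ the following are equivalent: 1. $B$ is atomic; 2. $B$ is completely representable; 3. $B$ is meet-completely representable; 4. $B$ is join-completely representable.
   Context: A representation of a bounded distributive lattice $L$ (in particular of a Boolean algebra) is a lattice embedding $h\colon L\to\wp(X)$ for some set $X$, where $\wp(X)$ is regarded as a ring of sets under union and intersection; representations are assumed irredundant, i.e. for every $x\in X$ there is $a\in L$ with $x\in h(a)$. A lattice map $f\colon L_1\to L_2$ is meet-complete if for all $S\subseteq L_1$ such that $\bigwedge S$ exists in $L_1$ we have $f(\bigwedge_{L_1}S)=\bigwedge_{L_2}f[S]$; join-complete is defined dually; a map is complete if it is both. $L$ is (meet-/join-)completely representable if it has a (meet-/join-)complete representation. *)

(* Defs.v *)
From mathcomp Require Import all_boot all_order.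
From mathcomp Require Import boolp classical_sets.

Set Implicit Arguments.
Unset Strict Implicit.
Unset Printing Implicit Defensive.

Local Open Scope classical_set_scope.
Local Open Scope order_scope.

(* [infimums S a] reads "the infimum of S exists and is a". The set S ranges
   over all subsets of the domain, including the empty one. *)
Definition meet_complete d1 (L1 : latticeType d1) d2 (L2 : latticeType d2)
    (f : {lmorphism L1 -> L2}) : Prop :=
  forall (S : set L1) (a : L1), infimums S a -> infimums (f @` S) (f a).

Definition join_complete d1 (L1 : latticeType d1) d2 (L2 : latticeType d2)
    (f : {lmorphism L1 -> L2}) : Prop :=
  forall (S : set L1) (a : L1), supremums S a -> supremums (f @` S) (f a).

Definition complete_map d1 (L1 : latticeType d1) d2 (L2 : latticeType d2)
    (f : {lmorphism L1 -> L2}) : Prop :=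
  meet_complete f /\ join_complete f.

(* [set X] carries its library lattice structure: the order is inclusion, meet
   is intersection and join is union. A lattice morphism is not required to
   preserve bottom and top; irredundancy forces [h \top = setT]. *)
Definition representation d (L : tbDistrLatticeType d) (X : Type)
    (h : {lmorphism L -> set X}) : Prop :=
  injective h /\ (forall x : X, exists a : L, h a x).

Definition completely_representable d (L : tbDistrLatticeType d) : Prop :=
  exists (X : Type) (h : {lmorphism L -> set X}),
    representation h /\ complete_map h.

Definition meet_completely_representable d (L : tbDistrLatticeType d) : Prop :=
  exists (X : Type) (h : {lmorphism L -> set X}),
    representation h /\ meet_complete h.

Definition join_completely_representable d (L : tbDistrLatticeType d) : Prop :=
  exists (X : Type) (h : {lmorphism L -> set X}),
    representation h /\ join_complete h.

Definition atom d (L : tbDistrLatticeType d) (a : L) : Prop :=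
  a <> \bot /\ (forall b : L, b <= a -> b = \bot \/ b = a).

Definition atomic d (L : tbDistrLatticeType d) : Prop :=
  forall b : L, b <> \bot -> exists a : L, atom a /\ a <= b.

(* Main.v *)
(** If [h] is a representation of a Boolean algebra [B] and the point [x] lies
    outside [h \bot], then [F := {a | h a x}] is an ultrafilter, so a nonzero
    lower bound of [F] is an atom. If [F] had no nonzero lower bound, then
    [F] would have infimum [\bot] and the complements of its members supremum
    [\top], and [x] would witness that neither is preserved by [h].
    Conversely, when [B] is atomic, sending [b] to the set of atoms below [b]
    is a complete representation. *)
Require Import Defs.
From mathcomp Require Import all_boot all_order.
From HB Require Import structures.
From mathcomp Require Import boolp classical_sets.

Set Implicit Arguments.
Unset Strict Implicit.
Unset Printing Implicit Defensive.

Import Order.Theory.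

Local Open Scope classical_set_scope.
Local Open Scope order_scope.

Section PointFilter.
Context (d : Order.disp_t) (B : ctbDistrLatticeType d) (X : Type).
Context (h : {lmorphism B -> set X}).
Implicit Types (a b c : B) (x : X).

Lemma lmorphism_setI a b x : h (a `&` b) x <-> h a x /\ h b x.
Proof. by rewrite Order.LatticeMorphismTheory.omorphI. Qed.

Lemma lmorphism_setU a b x : h (a `|` b) x <-> h a x \/ h b x.
Proof. by rewrite Order.LatticeMorphismTheory.omorphU. Qed.

Lemma lmorphism_set_le a b x : a <= b -> h a x -> h b x.
Proof. by move=> /meet_idPl <- /lmorphism_setI[]. Qed.

(** As [x] lies in [h \top], for [b <= c] it lies in [h b] or in the image of the complement of [b].
    The first case gives [c <= b]; the second puts [c] below that complement, so [b] is disjoint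
    from itself. *)
Lemma lbound_point_filter_atom x c :
  h \top x -> lbound [set a | h a x] c -> c <> \bot -> atom c.
Proof.
move=> htx lbc c0; split=> // b bc.
have : h (b `|` ~` b) x by rewrite joinxC.
case/lmorphism_setU => [hb|hCb].
  by right; apply/le_anti; rewrite bc lbc.
by left; apply/eqP; rewrite -[b]meetxx disj_leC (le_trans bc)// lbc.
Qed.

(** Injectivity yields a point [x] of [h b] outside [h \bot]; since [b] belongs to the filter at
    [x], the bound [c] lies below [b]. *)
Lemma atomic_lbound_point_filter : injective h ->
  (forall x, ~ h \bot x -> exists2 c, lbound [set a | h a x] c & c <> \bot) ->
  atomic B.
Proof.
move=> hI hF b b0.
have [x [hbx /hF[c lbc c0]]] : exists x, h b x /\ ~ h \bot x.
  apply: contra_notP b0 => /forallNP Nx; apply/hI/seteqP.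
  split=> x hx; last exact: lmorphism_set_le hx.
  by apply: contrapT => hNx; apply: (Nx x).
exists c; split; last exact: lbc.
exact: (lbound_point_filter_atom (lmorphism_set_le (lex1 b) hbx)).
Qed.

Lemma meet_complete_lbound_point_filter x : meet_complete h -> ~ h \bot x ->
  exists2 c, lbound [set a | h a x] c & c <> \bot.
Proof.
move=> hM hbx; apply: contra_notP hbx => /forall2NP lbN.
have inf0 : infimums [set a | h a x] \bot.
  split=> [a _|c lbc]; first exact: le0x.
  by have [//|/contrapT ->] := lbN c.
(* The singleton of [x] is below every member of the image, so preservation would place it below
   [h \bot]. *)
have [_ /(_ [set x]%classic) glb] := hM _ _ inf0.
suff /glb /subsetPset/(_ x) : lbound (h @` [set a | h a x]) [set x]%classic.
  exact.
by move=> _ [a hax <-]; apply/subsetPset => _ ->.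
Qed.

Lemma join_complete_lbound_point_filter x : join_complete h ->
  h \top x -> ~ h \bot x -> exists2 c, lbound [set a | h a x] c & c <> \bot.
Proof.
move=> hJ htx hbx; apply: contra_notP hbx => /forall2NP lbN.
have sup1 : supremums [set ~` a | a in [set a | h a x]] \top.
  split=> [a _|c ubc]; first exact: lex1.
  have [[]|/contrapT/eqP] := lbN (~` c).
    by move=> a hax; rewrite leCx; apply: ubc; exists a.
  by rewrite -compl1 (inj_eq compl_inj) => /eqP ->.
(* Dually, the test set is everything but [x]: if [h] sent the complement of a filter member to a
   set containing [x], then [x] would lie in [h \bot]. *)
have [_ /(_ (~` [set x])%classic) lub] := hJ _ _ sup1.
apply: contrapT => hbx.
suff /lub /subsetPset/(_ x htx) :
  ubound (h @` [set ~` a | a in [set a | h a x]]) (~` [set x])%classic by apply.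
move=> _ [_ [a hax <-] <-]; apply/subsetPset => y hCay yx; apply: hbx.
by rewrite -(meetxC a); apply/lmorphism_setI; rewrite -{2}yx.
Qed.

End PointFilter.

Section AtomRepresentation.
Context (d : Order.disp_t) (B : ctbDistrLatticeType d).
Implicit Types (a b c : B).

Lemma atom_le_compl a b : atom a -> ~ a <= b -> a <= ~` b.
Proof.
move=> [_ aP] ab; rewrite -disj_leC; apply/eqP.
by have [//|/meet_idPl] := aP _ (leIl a b).
Qed.

(** Otherwise [b] meets the complement of [c], and an atom below that meet would lie below both [c]
    and its complement. *)
Lemma le_atoms b c : atomic B ->
  (forall a, atom a -> a <= b -> a <= c) -> b <= c.
Proof.
move=> atB bc; rewrite -[c]complK -disj_leC; apply/eqP; apply: contrapT.
move=> /atB[a [ata]]; rewrite lexI => /andP[/(bc _ ata) ac aCc].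
by case: ata => + _; apply; apply/eqP; rewrite -lex0 -(meetxC c) lexI ac.
Qed.

Definition atoms_below b : set {a : B | atom a} := [set x | sval x <= b].

Fact atoms_below_le : {homo atoms_below : b c / b <= c}.
Proof. by move=> b c bc; apply/subsetPset => x /= /le_trans; apply. Qed.

Fact atoms_below_meet : Order.meet_morphism atoms_below.
Proof.
by move=> b c; apply/seteqP; split=> x;
  rewrite /atoms_below /= lexI => /andP.
Qed.

Fact atoms_below_join : Order.join_morphism atoms_below.
Proof.
move=> b c; apply/seteqP; split=> x; rewrite /atoms_below /=; last first.
  by case=> /le_trans; apply; [exact: leUl|exact: leUr].
(* An atom below neither [b] nor [c] is below both complements, hence disjoint from the join. *)
move=> xbc; apply: contrapT => /not_orP[xb xc].
have [x0 _] := svalP x; apply: x0; apply/eqP; rewrite -lex0.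
by rewrite -(meetxC (b `|` c)) lexI xbc complU lexI
  !atom_le_compl//; exact: svalP.
Qed.

HB.instance Definition _ :=
  Order.isOrderMorphism.Build _ _ _ _ atoms_below atoms_below_le.
HB.instance Definition _ := Order.isLatticeMorphism.Build _ _ _ _ atoms_below
  atoms_below_meet atoms_below_join.

Lemma atoms_below_representation :
  atomic B -> representation (atoms_below : {lmorphism B -> set _}).
Proof.
move=> atB; split=> [b c bc|x]; last by exists \top; exact: lex1.
apply/le_anti/andP; split; apply: le_atoms => // a ata ab.
  by have : atoms_below b (exist _ a ata) by []; rewrite bc.
by have : atoms_below c (exist _ a ata) by []; rewrite -bc.
Qed.

Lemma atoms_below_meet_complete :
  meet_complete (atoms_below : {lmorphism B -> set _}).
Proof.
move=> S b [lbS glbS]; split=> [_ [s Ss <-]|A lbA].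
  exact/atoms_below_le/lbS.
(* Each atom in [A] is itself a lower bound of [S]. *)
apply/subsetPset => x Ax; apply: glbS => s Ss.
by have /subsetPset/(_ x Ax) := lbA _ (imageP _ Ss).
Qed.

Lemma atoms_below_join_complete :
  join_complete (atoms_below : {lmorphism B -> set _}).
Proof.
move=> S b [ubS lubS]; split=> [_ [s Ss <-]|A ubA].
  exact/atoms_below_le/ubS.
(* An atom missing from [A] is below no member of [S], so its complement bounds [S] and hence [b]
   from above, which makes the atom [\bot]. *)
apply/subsetPset => x xb; apply: contrapT => NAx.
have [x0 _] := svalP x; apply: x0; apply/eqP; rewrite -lex0.
rewrite -(meetxC (sval x)) lexI lexx (le_trans xb)//.
apply: lubS => s Ss; rewrite lexC atom_le_compl//; first exact: svalP.
by move=> xs; apply: NAx; have /subsetPset := ubA _ (imageP _ Ss); apply.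
Qed.

End AtomRepresentation.

Theorem corollary2p12 (d : Order.disp_t) (B : ctbDistrLatticeType d) :
  [<-> atomic B;
       completely_representable B;
       meet_completely_representable B;
       join_completely_representable B].
Proof.
have atomic_complete : atomic B -> completely_representable B.
  move=> atB; exists _, (@atoms_below d B : {lmorphism B -> set _}).
  split; first exact: atoms_below_representation.
  by split; [exact: atoms_below_meet_complete|exact: atoms_below_join_complete].
tfae=> [//|||].
- by case=> X [h [hR [hM _]]]; exists X, h.
(* This implication passes through atomicity. *)
- case=> X [h [[hI _] hM]].
  have [|Y [k [kR [_ kJ]]]] := atomic_complete; last by exists Y, k.
  apply: (atomic_lbound_point_filter hI) => x.
  exact: meet_complete_lbound_point_filter.
- case=> X [h [[hI hirr] hJ]].
  apply: (atomic_lbound_point_filter hI) => x.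
  apply: join_complete_lbound_point_filter => //.
  (* Irredundancy places [x] in some [h a], hence in [h \top]. *)
  by have [a] := hirr x; apply: lmorphism_set_le; exact: lex1.
Qed.
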